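(* Let $0\le q_1,q_2\le 1/2$. The common-message capacity of the binary multiple access channel with one dirty user, $Y=X_1\oplus X_2\oplus S_1$, with $S_1\sim$ Bernoulli$(1/2)$ known non-causally at the encoder of user 1 only and with input constraints $q_1,q_2$, is $$C_{com}=H_b(q_1).$$
   Context: Notation: $\oplus$ is addition mod 2 (componentwise on vectors), $w_H$ is Hamming weight, $H_b(x)=-x\log_2x-(1-x)\log_2(1-x)$ is the binary entropy function. Channel: inputs $X_1,X_2\in\{0,1\}$, output $Y=X_1\oplus X_2\oplus S_1$, where the interference sequence $\mathbf{s}_1\in\{0,1\}^n$ has i.i.d. Bernoulli$(1/2)$ entries and is independent of the message. Both users transmit the same (common) message $W$, uniform on a set $\mathcal{W}$. A code of length $n$ consists of encoders $\mathbf{x}_1=\phi_1(W,\mathbf{s}_1)$, $\mathbf{x}_2=\phi_2(W)$ in $\{0,1\}^n$ satisfying $\frac1n w_H(\mathbf{x}_i)\le q_i$ for $i=1,2$, and a decoder estimating $W$ from $\mathbf{y}=\mathbf{x}_1\oplus\mathbf{x}_2\oplus\mathbf{s}_1$. The common-message capacity $C_{com}$ is the supremum of rates $R$ for which there is a sequence of codes with $\frac1n\log_2|\mathcal{W}|\to R$ and error probability tending to $0$ as $n\to\infty$. Known single-letter formula for this capacity (Somekh-Baruch, Shamai, Verdú), which may be taken as given: $$C_{com}=\max\{I(U_1,X_2;Y)-I(U_1,X_2;S_1)\},$$ the maximum being over joint distributions $P(S_1)P(X_2)P(U_1|X_2,S_1)P(X_1|S_1,U_1)P(Y|X_1,X_2,S_1)$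 with $EX_i\le q_i$, $i=1,2$. *)

(* Defs.v *)
From HB Require Import structures.
From mathcomp Require Import all_boot all_order all_algebra.
From mathcomp Require Import all_classical all_reals all_analysis.

Set Implicit Arguments.
Unset Strict Implicit.
Unset Printing Implicit Defensive.

Import Order.TTheory GRing.Theory Num.Theory.
Import numFieldNormedType.Exports.

Local Open Scope classical_set_scope.
Local Open Scope ring_scope.

Definition log2 (R : realType) (x : R) : R := ln x / ln 2.

(* Since [ln 0 = 0], the convention 0 log 0 = 0 holds. *)
Definition binary_entropy (R : realType) (x : R) : R :=
  - x * log2 x - (1 - x) * log2 (1 - x).

Definition bits (n : nat) := {ffun 'I_n -> bool}.

Definition xorb_vec (n : nat) (x y : bits n) : bits n :=
  [ffun i => x i (+) y i].

Definition hamming_weight (n : nat) (x : bits n) : nat := #|[set i | x i]%SET|.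

Definition interference_pmf (R : realType) (n : nat) (s : bits n) : R :=
  \prod_(i < n) bernoulli_pmf (2^-1 : R) (s i).

Definition channel (n : nat) (x1 x2 s1 : bits n) : bits n :=
  xorb_vec (xorb_vec x1 x2) s1.

(* A code of length n for the message set W. Only encoder 1 sees the whole
   (non-causally known) interference sequence. Having a decoder forces W to be
   nonempty. *)
Record mac_code (n : nat) (W : finType) := MacCode {
  enc1 : W -> bits n -> bits n;
  enc2 : W -> bits n;
  dec : bits n -> W }.

Definition satisfies_constraints (R : realType) (q1 q2 : R) (n : nat)
    (W : finType) (c : mac_code n W) : Prop :=
  (forall w s1, n%:R^-1 * (hamming_weight (enc1 c w s1))%:R <= q1) /\
  (forall w, n%:R^-1 * (hamming_weight (enc2 c w))%:R <= q2).

(* Probability that the decoded message differs from W, for W uniform and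
   independent of the interference. *)
Definition error_probability (R : realType) (n : nat) (W : finType)
    (c : mac_code n W) : R :=
  \sum_(w : W) \sum_(s1 : bits n | dec c (channel (enc1 c w s1) (enc2 c w) s1) != w)
    #|W|%:R^-1 * interference_pmf R s1.

Definition code_rate (R : realType) (n : nat) (W : finType) : R :=
  n%:R^-1 * log2 (#|W|%:R : R).

(* The length n = 0 is included only for convenience (0^-1 = 0, so its rate and
   normalized weights are 0); it does not affect the limits. *)
Definition achievable (R : realType) (q1 q2 r : R) : Prop :=
  exists (W : nat -> finType) (c : forall n, mac_code n (W n)),
    [/\ forall n, satisfies_constraints q1 q2 (c n),
        (fun n => code_rate R n (W n)) @ \oo --> r &
        (fun n => error_probability R (c n)) @ \oo --> (0 : R)].

(* Taken in the extended reals, so that being equal to a real number includes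
   that some rate is achievable and that the achievable rates are bounded. *)
Definition common_message_capacity (R : realType) (q1 q2 : R) : \bar R :=
  ereal_sup [set r%:E | r in [set r : R | achievable q1 q2 r]].

(* Main.v *)
Require Import Defs.
From mathcomp Require Import all_boot all_order all_algebra.
From mathcomp Require Import all_classical all_reals all_analysis.
From mathcomp Require Import ring lra.

(* Converse: a message w and an output y leave at most as many interference
   sequences s1 as there are inputs x1 of user 1, so the number of correctly
   decoded pairs (w, s1) is at most 2^n times the volume B of the Hamming ball
   of radius n q1; hence |W| (1 - P_e) <= B <= 2^(n H_b(q1)).
   Achievability: user 2 stays silent. The words of {0,1}^n are colored at
   random with about B / n colors, the colors being the messages, and user 1
   moves s1 to a word of color w inside the ball of radius n q1 around s1. The
   average failure probability is (1 - 1/|W|)^B = O(1/n). *)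

Set Implicit Arguments.
Unset Strict Implicit.
Unset Printing Implicit Defensive.

Import Order.TTheory GRing.Theory Num.Theory.
Import numFieldNormedType.Exports.

Local Open Scope classical_set_scope.
Local Open Scope ring_scope.

(** * Hamming weights and Hamming balls *)

Lemma hamming_weight_le n (x : bits n) : (hamming_weight x <= n)%N.
Proof. by rewrite /hamming_weight (leq_trans (max_card _)) ?card_ord. Qed.

Lemma prod_bits (R : comPzRingType) (p q : R) n (x : bits n) :
  \prod_(i < n) (if x i then p else q) =
  p ^+ hamming_weight x * q ^+ (n - hamming_weight x).
Proof.
rewrite (bigID (fun i => x i)) /=; congr (_ * _).
  rewrite (eq_bigr (fun=> p)) => [|i ->//].
  by rewrite prodr_const; congr (_ ^+ _); apply: eq_card => i; rewrite !inE.
rewrite (eq_bigr (fun=> q)) => [|i /negbTE->//].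
rewrite prodr_const; congr (_ ^+ _).
have := cardsC [set i | x i]%SET.
rewrite -/(hamming_weight x) card_ord => /esym/(canLR (addKn _)) ->.
by rewrite /hamming_weight; apply: eq_card => i; rewrite !inE.
Qed.

(** Expanding the product of n sums gives one term per bit vector. For p + q = 1, this says that the
    product Bernoulli measure has total mass 1. *)
Lemma sum_bits_pow (R : comPzRingType) (p q : R) n :
  \sum_(x : bits n) p ^+ hamming_weight x * q ^+ (n - hamming_weight x) =
  (p + q) ^+ n.
Proof.
under eq_bigr do rewrite -prod_bits.
rewrite -(bigA_distr_bigA (fun (_ : 'I_n) (b : bool) => if b then p else q)).
by rewrite (eq_bigr (fun=> p + q)) ?prodr_const ?card_ord// => i _; rewrite big_bool.
Qed.

Lemma card_hamming_weight n k :
  #|[set x : bits n | hamming_weight x == k]%SET| = 'C(n, k).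
Proof.
rewrite -[n in RHS]card_ord -card_draws.
have inj : injective (fun x : bits n => [set i | x i]%SET).
  move=> x y /setP xy; apply/ffunP => i.
  by have := xy i; rewrite !inE.
rewrite -(card_imset _ inj); apply: eq_card => A; rewrite !inE.
apply/imsetP/idP => [[x]|cA]; first by rewrite inE => kx ->.
exists [ffun i => i \in A]; last by apply/setP => i; rewrite !inE ffunE.
rewrite inE /hamming_weight -(eqP cA) eq_sym.
by apply/eqP; apply: eq_card => i; rewrite !inE ffunE.
Qed.

Definition zero_bits n : bits n := [ffun=> false].

Lemma hamming_weight0 n : hamming_weight (zero_bits n) = 0%N.
Proof.
by apply/eqP; rewrite cards_eq0; apply/eqP/setP => i; rewrite !inE ffunE.
Qed.

(** The normalized form matches the input constraint literally, so membership and admissibility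
    coincide for n = 0 as well. *)
Definition hamming_ball (R : realType) (q : R) n : {set bits n} :=
  [set x | n%:R^-1 * (hamming_weight x)%:R <= q]%SET.

Lemma in_hamming_ball (R : realType) (q : R) n (x : bits n) : (0 < n)%N ->
  (x \in hamming_ball q n) = ((hamming_weight x)%:R <= n%:R * q).
Proof.
by move=> n0; rewrite inE mulrC ler_pdivrMr ?ltr0n// mulrC.
Qed.

Lemma card_hamming_ball_gt0 (R : realType) (q : R) n : 0 <= q ->
  (0 < #|hamming_ball q n|)%N.
Proof.
move=> q0; apply/card_gt0P; exists (zero_bits n).
by rewrite inE hamming_weight0 mulr0.
Qed.

(** * Binary logarithm and the entropy upper bound on the volume of a ball *)

Lemma ln2_gt0 (R : realType) : 0 < ln 2 :> R.
Proof. by rewrite ln_gt0 // ltr1n. Qed.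

Lemma log2M (R : realType) (x y : R) : 0 < x -> 0 < y ->
  log2 (x * y) = log2 x + log2 y.
Proof. by move=> x0 y0; rewrite /log2 lnM ?posrE// mulrDl. Qed.

Lemma log2Xn (R : realType) (x : R) n : 0 < x -> log2 (x ^+ n) = n%:R * log2 x.
Proof. by move=> x0; rewrite /log2 lnXn// mulr_natl mulrnAl. Qed.

Lemma log2_le (R : realType) (x y : R) : 0 < x -> x <= y -> log2 x <= log2 y.
Proof.
move=> x0 xy; rewrite /log2 ler_pM2r ?invr_gt0 ?ln2_gt0//.
by rewrite ler_ln ?posrE// (lt_le_trans x0).
Qed.

Lemma log2_1 (R : realType) : log2 1 = 0 :> R.
Proof. by rewrite /log2 ln1 mul0r. Qed.

Lemma log2_2 (R : realType) : log2 2 = 1 :> R.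
Proof. by rewrite /log2 divff// gt_eqF// ln2_gt0. Qed.

Lemma binary_entropy0 (R : realType) : binary_entropy 0 = 0 :> R.
Proof. by rewrite /binary_entropy subr0 log2_1 oppr0 mul0r mulr0 subrr. Qed.

(** Under the product Bernoulli(q) measure, some word of the ball has mass at most 1/B, while q <=
    1/2 gives every word of the ball mass at least 2^(-n H_b(q)). *)
Lemma log2_card_hamming_ball_le (R : realType) (q : R) n :
  (0 < n)%N -> 0 <= q <= 2^-1 ->
  log2 (#|hamming_ball q n|%:R) <= n%:R * binary_entropy q.
Proof.
move=> n0 /andP[]; rewrite le_eqVlt => /predU1P[<- _|q0 q12].
  rewrite binary_entropy0 mulr0 -[leRHS](log2_1 R); apply: log2_le.
    by rewrite ltr0n card_hamming_ball_gt0.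
  rewrite -[leRHS]/1%:R ler_nat -(bin0 n) -card_hamming_weight.
  apply: subset_leq_card; apply/fintype.subsetP => x.
  by rewrite in_hamming_ball// mulr0 inE lern0.
set B := #|_|; have B0 : (0 < B)%N by rewrite card_hamming_ball_gt0// ltW.
have q1 : 0 < 1 - q by lra.
have lqq : log2 q <= log2 (1 - q) by apply: log2_le => //; lra.
(* Otherwise each of the B words of the ball has mass above 1/B, and the total mass exceeds 1. *)
have [x xB] : exists2 x : bits n, x \in hamming_ball q n &
    B%:R * (q ^+ hamming_weight x * (1 - q) ^+ (n - hamming_weight x)) <= 1.
  apply: contrapT => /forall2NP h.
  pose F (x : bits n) := q ^+ hamming_weight x * (1 - q) ^+ (n - hamming_weight x).
  have : \sum_(x : bits n) F x = 1 by rewrite /F sum_bits_pow subrKC expr1n.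
  apply/eqP; rewrite gt_eqF//.
  have F0 x : 0 <= F x by rewrite mulr_ge0// exprn_ge0// ltW.
  apply: (@lt_le_trans _ _ (\sum_(x in hamming_ball q n) F x)).
    have -> : 1 = \sum_(x in hamming_ball q n) B%:R^-1 :> R.
      by rewrite sumr_const -/B -[RHS]mulr_natl divff// pnatr_eq0 -lt0n.
    apply: ltr_sum => [|x xB].
      by have /card_gt0P[y yB] := B0; apply/hasP; exists y; rewrite ?mem_index_enum.
    rewrite -[_^-1]mul1r ltr_pdivrMr ?ltr0n// mulrC ltNge.
    by case: (h x) => // /negP.
  by rewrite [leRHS](bigID (mem (hamming_ball q n)))/= lerDl sumr_ge0.
set w := hamming_weight x => le1.
have wn : (w <= n)%N := hamming_weight_le x.
have wq : w%:R <= n%:R * q by rewrite -in_hamming_ball.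
have := log2_le _ le1; rewrite log2_1 !log2M ?exprn_gt0 ?ltr0n//; last first.
  by rewrite mulr_gt0 ?exprn_gt0.
rewrite !log2Xn// natrB// !mulr_gt0 ?ltr0n ?exprn_gt0// => /(_ isT).
rewrite /binary_entropy; set a := log2 q in lqq *; set b := log2 (1 - q) in lqq *.
(* This product is the gain in log-mass of a word of weight w over the value -n H_b(q), which
   corresponds to weight n q. *)
have : 0 <= (n%:R * q - w%:R) * (b - a) by rewrite mulr_ge0 ?subr_ge0.
by lra.
Qed.

(** * Converse: counting correctly decoded pairs *)

Lemma interference_pmfE (R : realType) n (s : bits n) :
  interference_pmf R s = (2 ^ n)%:R^-1.
Proof.
rewrite /interference_pmf (eq_bigr (fun=> 2^-1)) => [|i _].
  by rewrite prodr_const card_ord natrX exprVn.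
by rewrite /bernoulli_pmf; case: (s i) => //; lra.
Qed.

Definition decoding_errors n (W : finType) (c : mac_code n W) :
    {set W * bits n} :=
  [set p | dec c (channel (enc1 c p.1 p.2) (enc2 c p.1) p.2) != p.1]%SET.

Lemma card_bits n : #|{: bits n}| = (2 ^ n)%N.
Proof. by rewrite card_ffun card_bool card_ord. Qed.

(** Message and interference are both uniform, so all pairs are equally likely and the probability
    is a ratio of cardinalities. *)
Lemma error_probabilityE (R : realType) n (W : finType) (c : mac_code n W) :
  error_probability R c = #|decoding_errors c|%:R / (#|W| * 2 ^ n)%:R.
Proof.
rewrite /error_probability pair_big_dep/=.
rewrite (eq_bigr (fun=> (#|W| * 2 ^ n)%:R^-1)) => [|p _].
  rewrite sumr_const mulr_natl; congr (_ *+ _).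
  by apply: eq_card => p; rewrite !inE.
by rewrite interference_pmfE natrM invfM.
Qed.

Lemma code_card_gt0 n (W : finType) (c : mac_code n W) : (0 < #|W|)%N.
Proof. by apply/card_gt0P; exists (dec c [ffun=> false]). Qed.

Lemma xorb_vecK n (x y : bits n) : xorb_vec x (xorb_vec x y) = y.
Proof. by apply/ffunP => i; rewrite !ffunE addKb. Qed.

(* Given the output y, a correct decoder knows w, and then x1 determines the
   interference, so (x1, y) determines (w, s1). *)
Lemma card_correct_decodings_le (R : realType) (q1 q2 : R) n (W : finType)
    (c : mac_code n W) : satisfies_constraints q1 q2 c ->
  (#|~: decoding_errors c| <= #|hamming_ball q1 n| * 2 ^ n)%N.
Proof.
move=> [c1 _].
pose g (p : W * bits n) :=
  (enc1 c p.1 p.2, channel (enc1 c p.1 p.2) (enc2 c p.1) p.2).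
have inj : {in ~: decoding_errors c &, injective g}.
  move=> [w s] [w' s']; rewrite !inE !negbK /g /= => /eqP dw /eqP dw' [ex ey].
  have ww' : w = w' by rewrite -dw ey dw'.
  subst w'; move: ey; rewrite /channel ex.
  move/(congr1 (xorb_vec (xorb_vec (enc1 c w s') (enc2 c w)))).
  by rewrite !xorb_vecK => ->.
rewrite -(card_in_imset inj) -card_bits -cardsT -cardsX.
apply: subset_leq_card; apply/fintype.subsetP => _ /imsetP[p _ ->].
by rewrite !inE andbT c1.
Qed.

Lemma card_messages_le (R : realType) (q1 q2 : R) n (W : finType)
    (c : mac_code n W) : satisfies_constraints q1 q2 c ->
  #|W|%:R * (1 - error_probability R c) <= #|hamming_ball q1 n|%:R.
Proof.
move=> cc; have W0 := code_card_gt0 c.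
have p0 : (0 < 2 ^ n :> R) by rewrite exprn_gt0.
rewrite -(@ler_pM2r _ (2 ^ n)%:R) ?natrX//.
rewrite (le_trans (y := #|~: decoding_errors c|%:R))//; last first.
  by rewrite -natrX -natrM ler_nat (card_correct_decodings_le cc).
rewrite error_probabilityE cardsCs card_prod card_bits natrB; last first.
  by rewrite -card_bits -card_prod max_card.
rewrite natrM natrX le_eqVlt; apply/orP; left; apply/eqP.
by field; rewrite pnatr_eq0 -lt0n W0 gt_eqF.
Qed.

(** With error at most 1/2 the message set has at most 2B elements; the factor 2 costs one bit,
    hence 1/n in rate. *)
Lemma code_rate_le (R : realType) (q1 q2 : R) n (W : finType)
    (c : mac_code n W) : (0 < n)%N -> 0 <= q1 <= 2^-1 ->
  satisfies_constraints q1 q2 c -> error_probability R c <= 2^-1 ->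
  code_rate R n W <= binary_entropy q1 + n%:R^-1.
Proof.
move=> n0 hq cc err; have W0 := code_card_gt0 c.
rewrite /code_rate mulrC ler_pdivrMr ?ltr0n// mulrDl mulVf ?pnatr_eq0 -?lt0n//.
rewrite (le_trans (y := log2 (2 * #|hamming_ball q1 n|%:R)))//.
  apply: log2_le; first by rewrite ltr0n.
  have := card_messages_le cc; have : 0 <= #|W|%:R :> R by rewrite ler0n.
  by nra.
have q0 : 0 <= q1 by case/andP: hq.
rewrite log2M ?ltr0n ?card_hamming_ball_gt0// log2_2 addrC lerD2r mulrC.
exact: log2_card_hamming_ball_le.
Qed.

Lemma cvg_invn (R : realType) : (fun n => n%:R^-1 : R) @ \oo --> (0 : R).
Proof.
apply/gtr0_cvgV0; last exact: cvgr_idn.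
by near=> n; rewrite ltr0n; near: n; exact: nbhs_infty_gt.
Unshelve. all: by end_near. Qed.

Lemma achievable_le (R : realType) (q1 q2 r : R) : 0 <= q1 <= 2^-1 ->
  achievable q1 q2 r -> r <= binary_entropy q1.
Proof.
move=> hq [W [c [cc rate err]]].
have ub : (fun n => binary_entropy q1 + n%:R^-1 : R) @ \oo --> binary_entropy q1.
  rewrite -[X in _ --> X]addr0; apply: cvgD; first exact: cvg_cst.
  exact: cvg_invn.
apply: (ler_cvg_to rate ub); near=> n; apply: (code_rate_le (c := c n)) => //.
  by near: n; exact: nbhs_infty_gt.
by near: n; apply: cvgr_le err _ _; rewrite invr_gt0.
Unshelve. all: by end_near. Qed.

(** * Achievability: random colorings and the code built from them *)

Lemma card_avoiding_colorings (T W : finType) (A : {set T}) (w : W) :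
  #|[set f : {ffun T -> W} | [forall y in A, f y != w]]%SET| =
  (#|W|.-1 ^ #|A| * #|W| ^ (#|T| - #|A|))%N.
Proof.
pose F y : pred W := if y \in A then predC1 w else predT.
transitivity #|(family F : simpl_pred {ffun T -> W})|.
  apply: eq_card => f; rewrite inE; apply/forall_inP/familyP => [h y|h y yA].
    by rewrite /F; case: ifP => [/h|].
  by have := h y; rewrite /F yA.
rewrite card_family foldrE big_image/= (bigID (mem A))/=; congr (_ * _)%N.
  rewrite (eq_bigr (fun=> #|W|.-1)) ?prod_nat_const// => y yA.
  by rewrite /F yA -(cardC1 w); apply: eq_card.
rewrite (eq_bigr (fun=> #|W|)) => [|y /negbTE yA]; last by rewrite /F yA; apply: eq_card.
rewrite prod_nat_const; congr (_ ^ _)%N.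
by rewrite -(cardC A) addKn; apply: eq_card => y; rewrite !inE.
Qed.

(* The first moment method: the left-hand side, averaged over all colorings f,
   equals the right-hand side. *)
Lemma exists_good_coloring (S T W : finType) (A : S -> {set T}) b :
  (0 < #|W|)%N -> (forall s, #|A s| = b) ->
  exists f : {ffun T -> W},
    (#|[set p : W * S | [forall y in A p.2, f y != p.1]]%SET| * #|W| ^ b <=
     #|W|.-1 ^ b * (#|W| * #|S|))%N.
Proof.
move=> W0 Ab; apply: contrapT => /forallNP h.
pose N (f : {ffun T -> W}) :=
  #|[set p : W * S | [forall y in A p.2, f y != p.1]]%SET|.
have sumN : (\sum_f N f * #|W| ^ b =
    #|W|.-1 ^ b * (#|W| * #|S|) * #|W| ^ #|T|)%N.
  rewrite -big_distrl/=.
  under eq_bigr do rewrite /N -sum1dep_card.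
  rewrite (exchange_big_dep predT)//=.
  under eq_bigr => p _.
    rewrite sum1dep_card card_avoiding_colorings Ab.
    over.
  rewrite sum_nat_const card_prod.
  (* The bound b <= |T|, needed because the exponent |T| - b is a truncated subtraction, comes from
     an element of [S]; for empty [S] both sides vanish. *)
  have [s _|S0] := pickP (@predT S).
    have bT : (b <= #|T|)%N by rewrite -(Ab s) max_card.
    by rewrite -[in RHS](subnK bT) expnD; ring.
  by rewrite (eq_card0 S0) !(muln0, mul0n).
have : (\sum_(f : {ffun T -> W}) (#|W|.-1 ^ b * (#|W| * #|S|)).+1 <=
    \sum_f N f * #|W| ^ b)%N.
  by apply: leq_sum => f _; rewrite ltnNge; apply/negP/h.
rewrite sumN sum_nat_const card_ffun mulnC leq_pmul2r ?expn_gt0 ?W0//.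
by rewrite ltnn.
Qed.

Lemma bernoulli_inequality (R : realDomainType) (x : R) n : 0 <= x ->
  1 + n%:R * x <= (1 + x) ^+ n.
Proof.
move=> x0; elim: n => [|n ih]; first by rewrite expr0 mul0r addr0.
rewrite exprSr (le_trans _ (ler_wpM2r _ ih))//; last by lra.
rewrite -natr1; have : 0 <= n%:R * x * x by rewrite !mulr_ge0.
by lra.
Qed.

(** The ratio is (1 - 1/m)^b. Since (1 - 1/m)(1 + 1/m) <= 1 and (1 + 1/m)^b >= 1 + b/m, it is at
    most m/b, and m (n + 1) <= 2b once b >= n + 1. *)
Lemma failure_ratio_le (R : realFieldType) (b n m : nat) :
  (0 < b)%N -> m = (b %/ n.+1).+1 ->
  (m.-1 ^ b)%:R / (m ^ b)%:R <= 2 / n.+1%:R :> R.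
Proof.
move=> b0 mE; have [bn|nb] := ltnP b n.+1.
  (* Here m = 1: with a single message the numerator is 0^b, which is 0 because b > 0. *)
  by rewrite mE divn_small//= exp0n// mul0r divr_ge0.
have m0 : (0 < m)%N by rewrite mE.
have mn : (m * n.+1 <= 2 * b)%N.
  by rewrite mE mulSn addnC mul2n -addnn leq_add// leq_divM.
have M0 : 0 < m%:R :> R by rewrite ltr0n.
have N0 : 0 < n.+1%:R :> R by rewrite ltr0n.
have mnR : m%:R * n.+1%:R <= 2 * b%:R :> R by rewrite -!natrM ler_nat.
rewrite !natrX -expr_div_n.
have -> : m.-1%:R / m%:R = 1 - m%:R^-1 :> R.
  by rewrite -subn1 natrB// mulrBl divff ?gt_eqF// mul1r.
have i0 : 0 < m%:R^-1 :> R by rewrite invr_gt0.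
have i1 : m%:R^-1 <= 1 :> R by rewrite invf_le1// ler1n.
have bern := @bernoulli_inequality R _ b (ltW i0).
have : (1 - m%:R^-1) ^+ b * (1 + m%:R^-1) ^+ b <= 1 :> R.
  rewrite -exprMn exprn_ile1//; last by have := mulr_gt0 i0 i0; lra.
  by rewrite mulr_ge0 ?subr_ge0// addr_ge0// ltW.
have : 0 <= (1 - m%:R^-1) ^+ b :> R by rewrite exprn_ge0// subr_ge0.
have bm : n.+1%:R / 2 <= b%:R / m%:R :> R.
  by rewrite ler_pdivrMr// mulrAC ler_pdivlMr// mulrC [leRHS]mulrC.
rewrite ler_pdivlMr//.
move: bern bm; set u := _ ^+ b; set v := _ ^+ b; set t := b%:R / _.
set N := n.+1%:R => bern bm v0 uv.
have : v * (N / 2) <= v * u by apply: ler_wpM2l => //; lra.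
by lra.
Qed.

(** The decoder is the coloring itself. When no admissible input yields color w, encoder 1 falls
    back on the zero word, so that the constraint holds even on failure. *)
Definition coloring_code (R : realType) (q : R) n (W : finType)
    (f : {ffun bits n -> W}) : mac_code n W :=
  MacCode
    (fun w s => odflt (zero_bits n)
       [pick x in hamming_ball q n | f (channel x (zero_bits n) s) == w])
    (fun=> zero_bits n) f.

Lemma coloring_code_constraints (R : realType) (q1 q2 : R) n (W : finType)
    (f : {ffun bits n -> W}) : 0 <= q1 -> 0 <= q2 ->
  satisfies_constraints q1 q2 (coloring_code q1 f).
Proof.
move=> q10 q20; split => [w s|w] /=; last by rewrite hamming_weight0 mulr0.
case: pickP => [x /andP[]|_]; first by rewrite inE.
by rewrite hamming_weight0 mulr0.
Qed.

(** The outputs reachable from s form a translate of the ball, of the same size for every s, and an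
    error forces this translate to miss the color w. The successor in ['I_m.+1] keeps the message
    set nonempty. *)
Lemma exists_good_code (R : realType) (q1 q2 : R) n m :
  0 <= q1 -> 0 <= q2 -> m = (#|hamming_ball q1 n| %/ n.+1)%N ->
  exists2 c : mac_code n 'I_m.+1, satisfies_constraints q1 q2 c &
    error_probability R c <= 2 / n.+1%:R.
Proof.
move=> q10 q20 mE; set b := #|_| in mE.
have b0 : (0 < b)%N by rewrite card_hamming_ball_gt0.
pose A (s : bits n) := [set channel x (zero_bits n) s | x in hamming_ball q1 n]%SET.
have Ab s : #|A s| = b.
  rewrite card_imset// => x y /ffunP xy; apply/ffunP => i.
  by have := xy i; rewrite !ffunE !addbF => /addIb.
have [|f hf] := exists_good_coloring (W := 'I_m.+1) _ Ab; first by rewrite card_ord.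
exists (coloring_code q1 f); first exact: coloring_code_constraints.
apply: le_trans (failure_ratio_le R b0 (congr1 S mE)).
rewrite error_probabilityE; rewrite card_ord card_bits in hf *.
rewrite ler_pdivrMr ?ltr0n ?muln_gt0 ?expn_gt0//.
rewrite mulrAC ler_pdivlMr ?ltr0n ?expn_gt0//.
rewrite -!natrM ler_nat; apply: leq_trans hf; rewrite leq_mul2r; apply/orP; right.
apply: subset_leq_card; apply/fintype.subsetP => -[w s]; rewrite !inE/=.
case: pickP => [x /andP[_ ->]//|h _].
apply/forall_inP => _ /imsetP[x xB ->].
by have := h x; rewrite xB/= => /negbT.
Qed.

(** * Lower bound on the volume of a ball *)

(* For k = floor (n q), the binomial weights increase up to index k and
   decrease from index k + 1 on. *)
Lemma binomial_weight_floor_ge (R : realType) (q : R) n k :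
  (0 < n)%N -> 0 < q -> q <= 2^-1 -> k%:R <= n%:R * q < k.+1%:R ->
  1 <= n.+1%:R ^+ 2 * ('C(n, k)%:R * (q ^+ k * (1 - q) ^+ (n - k))).
Proof.
move=> n0 q0 q12 /andP[kq qk].
pose a j : R := 'C(n, j)%:R * (q ^+ j * (1 - q) ^+ (n - j)).
have q1 : 0 < 1 - q by lra.
have a0 j : 0 <= a j by rewrite !mulr_ge0// exprn_ge0// ltW.
have N1 : 1 <= n%:R :> R by rewrite ler1n.
(* Ratio of consecutive binomial weights, written without division. *)
have step j : (j < n)%N ->
    j.+1%:R * (1 - q) * a j.+1 = (n%:R - j%:R) * q * a j.
  move=> jn; rewrite /a -(natrB _ (ltnW jn)).
  have -> : (n - j)%N = (n - j.+1).+1 by rewrite subnSK.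
  rewrite !exprS.
  have /(congr1 (fun i => i%:R : R)) := mul_bin_left n j.
  rewrite !natrM subnSK// => e.
  transitivity (j.+1%:R * 'C(n, j.+1)%:R * (1 - q) * q * q ^+ j * (1 - q) ^+ (n - j.+1)).
    by ring.
  by rewrite e; ring.
have knR : (k < n)%N.
  by rewrite -(ltr_nat R); nra.
have up i : (i <= k)%N -> a (k - i)%N <= a k.
  elim: i => [|i ih] ik; first by rewrite subn0.
  apply: le_trans (ih (ltnW ik)).
  have e : (k - i)%N = (k - i.+1).+1 by rewrite subnSK.
  rewrite e; set j := (k - i.+1)%N in e *.
  have jk : (j.+1 <= k)%N by rewrite -e leq_subr.
  have jn : (j < n)%N by rewrite (leq_trans jk)// ltnW.
  have jkR : j.+1%:R <= k%:R :> R by rewrite ler_nat.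
  have J0 : 0 <= j%:R :> R by rewrite ler0n.
  have := step j jn; rewrite -natr1 in jkR *.
  set x := a j; set y := a j.+1 => e'.
  have c0 : 0 < (j%:R + 1) * (1 - q) by rewrite mulr_gt0//; lra.
  rewrite -(ler_pM2l c0) e' ler_wpM2r ?a0//; nra.
have down i : a (k.+1 + i)%N <= a k.+1.
  elim: i => [|i ih]; first by rewrite addn0.
  apply: le_trans ih; rewrite addnS; set j := (k.+1 + i)%N.
  have [nj|jn] := leqP n j; first by rewrite {1}/a bin_small ?ltnS// mul0r.
  have kj : k.+1%:R <= j%:R :> R by rewrite ler_nat leq_addr.
  have := step j jn; rewrite -[j.+1%:R]natr1 => e'.
  have c0 : 0 < (j%:R + 1) * (1 - q) by rewrite mulr_gt0//; lra.
  rewrite -(ler_pM2l c0) e' ler_wpM2r ?a0//; nra.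
(* The largest weight may sit at k + 1 instead of k. The crude factor n, from q <= 1 - q, covers
   this case. *)
have ak1 : a k.+1 <= n%:R * a k.
  have := step k knR; rewrite -natr1 => e'.
  have K0 : 0 <= k%:R :> R by rewrite ler0n.
  have c0 : 0 < (k%:R + 1) * (1 - q) by rewrite mulr_gt0//; lra.
  rewrite -(ler_pM2l c0) e' [leRHS]mulrA ler_wpM2r ?a0//.
  have : (n%:R - k%:R) * q <= n%:R * (1 - q) by nra.
  have : 0 <= k%:R * (n%:R * (1 - q)) by rewrite !mulr_ge0// ltW.
  by lra.
have ale j : a j <= n.+1%:R * a k.
  have [jk|kj] := leqP j k.
    rewrite -(subKn jk) (le_trans (up _ (leq_subr _ _)))// ler_peMl ?a0//.
    by rewrite ler1n.
  rewrite -(subnKC kj) (le_trans (down _))// (le_trans ak1)// ler_wpM2r ?a0//.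
  by rewrite ler_nat.
(* The n + 1 weights sum to 1 and each is at most (n + 1) [a k], whence the square. *)
have sum1 : \sum_(j < n.+1) a j = 1.
  rewrite -[RHS](expr1n _ n) -{1}(subrK q 1) exprDn; apply: eq_bigr => j _.
  by rewrite /a -[RHS]mulr_natl [_ ^+ (n - j) * _]mulrC.
rewrite -/(a k) -[leLHS]sum1 (le_trans (ler_sum _ (fun (j : 'I_n.+1) _ => ale j)))//.
by rewrite sumr_const card_ord -[leLHS]mulr_natl mulrA.
Qed.

(** The words of weight k = floor(n q) lie in the ball, and their total mass is at least 1/(n +
    1)^2. The term [log2 q] pays for rounding n q down to k. *)
Lemma log2_card_hamming_ball_ge (R : realType) (q : R) n :
  (0 < n)%N -> 0 <= q <= 2^-1 ->
  n%:R * binary_entropy q + log2 q - 2 * log2 n.+1%:R <=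
  log2 #|hamming_ball q n|%:R.
Proof.
move=> n0 /andP[]; rewrite le_eqVlt => /predU1P[<- _|q0 q12].
  (* For q = 0 the default [ln 0 = 0] removes the term [log2 q], and a nonempty ball suffices. *)
  rewrite binary_entropy0 mulr0 {1}/log2 ln0// mul0r addr0 sub0r.
  have := card_hamming_ball_gt0 n (lexx (0 : R)); rewrite -(ler1n R).
  move/(log2_le ltr01); rewrite log2_1; apply: le_trans; rewrite oppr_le0.
  by rewrite mulr_ge0// -(log2_1 R) log2_le// ler1n.
have q1 : 0 < 1 - q by lra.
have nq0 : 0 <= n%:R * q by rewrite mulr_ge0// ltW.
have kq := truncn_itv nq0; set k := Num.truncn _ in kq.
have := binomial_weight_floor_ge n0 q0 q12 kq.
case/andP: kq => kq qk.
have kn : (k <= n)%N.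
  by rewrite -(ler_nat R) (le_trans kq)// ler_piMr//; lra.
have B0 : 0 < #|hamming_ball q n|%:R :> R.
  by rewrite ltr0n card_hamming_ball_gt0// ltW.
have p0 : 0 < q ^+ k * (1 - q) ^+ (n - k) by rewrite mulr_gt0// exprn_gt0.
have N0 : 0 < n.+1%:R ^+ 2 :> R by rewrite exprn_gt0// ltr0n.
move=> le1.
have : 1 <= n.+1%:R ^+ 2 * (#|hamming_ball q n|%:R * (q ^+ k * (1 - q) ^+ (n - k))).
  rewrite (le_trans le1)// ler_pM2l// ler_pM2r// ler_nat -card_hamming_weight.
  apply: subset_leq_card; apply/fintype.subsetP => x.
  by rewrite in_hamming_ball// inE => /eqP ->.
move/(log2_le ltr01); rewrite log2_1 !log2M ?mulr_gt0 ?exprn_gt0 ?(ltr0n _ n.+1)//.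
rewrite !log2Xn ?(ltr0n _ n.+1)// natrB//.
have : log2 q <= 0 by rewrite -(log2_1 R); apply: log2_le => //; lra.
have : log2 (1 - q) <= 0 by rewrite -(log2_1 R); apply: log2_le => //; lra.
rewrite /binary_entropy -natr1 in qk *.
set x := log2 q; set y := log2 (1 - q) => y0 x0.
(* The slack in the bound is the sum of this product and the next one, both nonnegative because k <=
   n q < k + 1. *)
have : 0 <= (k%:R + 1 - n%:R * q) * - x by rewrite mulr_ge0//; lra.
have : 0 <= (n%:R * q - k%:R) * - y by rewrite mulr_ge0//; lra.
by lra.
Qed.

(** * Limits of the rates and the capacity *)

Lemma cvg_log2S_div (R : realType) :
  (fun n => n%:R^-1 * log2 n.+1%:R : R) @ \oo --> (0 : R).
Proof.
have cvgV := @cvg_invn R.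
have ub : (fun n => Num.sqrt (2 * n%:R^-1) / ln 2 : R) @ \oo --> (0 : R).
  rewrite -(mul0r (ln 2)^-1); apply: cvgM; last exact: cvg_cst.
  have arg : (fun n => 2 * n%:R^-1 : R) @ \oo --> (0 : R).
    by rewrite -(mulr0 2); apply: cvgM => //; exact: cvg_cst.
  have := continuous_cvg _ (@sqrt_continuous R 0) arg; rewrite sqrtr0; exact.
apply: squeeze_cvgr (cvg_cst 0) ub; near=> n.
have n0 : (0 < n)%N by near: n; exact: nbhs_infty_gt.
have N0 : 0 < n%:R :> R by rewrite ltr0n.
have l0 : 0 <= ln n.+1%:R :> R by rewrite ln_ge0// ler1n.
(* The bound 1 + x^2/2 <= e^x at x = ln(n + 1) gives ln(n + 1)^2 <= 2n, hence the majorant sqrt(2/n)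
   used above. *)
have lnsq : ln n.+1%:R ^+ 2 <= 2 * n%:R :> R.
  have := @expR_ge1Dxn R _ 1 l0.
  rewrite lnK ?posrE ?ltr0n// -[X in _ <= X]natr1 (_ : 2`!%:R = 2)//; lra.
have v0 : 0 <= n%:R^-1 * ln n.+1%:R :> R by rewrite mulr_ge0// invr_ge0 ltW.
have ln2 := ln2_gt0 R.
rewrite /log2 mulrA ler_pM2r ?invr_gt0// divr_ge0 ?(ltW ln2)//=.
rewrite -[leLHS]ger0_norm// -sqrtr_sqr ler_wsqrtr//.
rewrite exprMn expr2 -mulrA mulrC ler_pdivrMr// mulrC ler_pdivrMr//.
by rewrite mulrAC divfK ?gt_eqF.
Unshelve. all: by end_near. Qed.

Lemma achievable_binary_entropy (R : realType) (q1 q2 : R) :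
  0 <= q1 <= 2^-1 -> 0 <= q2 -> achievable q1 q2 (binary_entropy q1).
Proof.
move=> hq1 q20; have q10 : 0 <= q1 by case/andP: hq1.
pose m n := (#|hamming_ball q1 n| %/ n.+1)%N.
pose c n := cid2 (exists_good_code q10 q20 (erefl (m n))).
exists (fun n => 'I_(m n).+1), (fun n => s2val (c n)).
have cvgV := @cvg_invn R.
have err0 : (fun n => error_probability R (s2val (c n))) @ \oo --> (0 : R).
  have ub : (fun n => 2 / n.+1%:R : R) @ \oo --> (0 : R).
    by rewrite -(mulr0 2); apply: cvgM; [exact: cvg_cst|exact: cvg_harmonic].
  apply: squeeze_cvgr (cvg_cst 0) ub; apply: nearW => n.
  by rewrite (s2valP' (c n)) andbT error_probabilityE divr_ge0.
split=> //; first by move=> n; exact: (s2valP (c n)).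
(* Of the three logarithms, two come from the lower bound on the ball and one from dividing its
   volume by n + 1. *)
pose lb n : R := binary_entropy q1 +
  (n%:R^-1 * log2 q1 - 3 * (n%:R^-1 * log2 n.+1%:R)).
have cvg_lb : lb @ \oo --> binary_entropy q1.
  rewrite -[X in _ --> X]addr0 -[X in _ --> _ + X]subr0.
  apply: cvgD; first exact: cvg_cst.
  apply: cvgB.
    by rewrite -(mul0r (log2 q1)); apply: cvgM => //; exact: cvg_cst.
  by rewrite -(mulr0 3); apply: cvgM; [exact: cvg_cst|exact: cvg_log2S_div].
have cvg_ub : (fun n => binary_entropy q1 + n%:R^-1 : R) @ \oo --> binary_entropy q1.
  by rewrite -[X in _ --> X]addr0; apply: cvgD => //; exact: cvg_cst.
apply: squeeze_cvgr cvg_lb cvg_ub; near=> n.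
have n0 : (0 < n)%N by near: n; exact: nbhs_infty_gt.
have N0 : 0 < n%:R :> R by rewrite ltr0n.
apply/andP; split; last first.
  (* The converse bound, applied to these codes once their error is at most 1/2, gives the upper
     half of the squeeze. *)
  apply: (code_rate_le n0 hq1 (s2valP (c n))).
  by near: n; apply: cvgr_le err0 _ _; rewrite invr_gt0.
rewrite /code_rate card_ord -(ler_pM2l N0) mulrA divff ?gt_eqF// mul1r.
have := log2_card_hamming_ball_ge n0 hq1.
have B0 : 0 < #|hamming_ball q1 n|%:R :> R by rewrite ltr0n card_hamming_ball_gt0.
have : #|hamming_ball q1 n|%:R <= (m n).+1%:R * n.+1%:R :> R.
  by rewrite -natrM ler_nat ltnW// ltn_ceil.
move/(log2_le B0); rewrite log2M ?ltr0n// /lb => h1 h2.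
set l := log2 n.+1%:R in h1 h2 *; set lq := log2 q1 in h2 *.
have -> : n%:R * (binary_entropy q1 + (n%:R^-1 * lq - 3 * (n%:R^-1 * l))) =
    n%:R * binary_entropy q1 + lq - 3 * l by field; rewrite gt_eqF.
by lra.
Unshelve. all: by end_near. Qed.

Theorem mainTheorem4 (R : realType) (q1 q2 : R)
    (hq1 : 0 <= q1 <= 2^-1) (hq2 : 0 <= q2 <= 2^-1) :
  common_message_capacity q1 q2 = (binary_entropy q1)%:E.
Proof.
apply/eqP; rewrite eq_le; apply/andP; split.
  apply: ge_ereal_sup => _ [r /= hr <-]; rewrite lee_fin.
  exact: achievable_le hr.
apply: ereal_sup_ubound; exists (binary_entropy q1) => //=.
by apply: achievable_binary_entropy => //; case/andP: hq2.
Qed.
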